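(* Let $(X,\mathcal{A},\mu,T)$ be an ergodic probability preserving system, $(A_l)_{l\geq1}$ a sequence of asymptotically rare events, and $(\nu_l)$ a sequence in $\mathfrak{P}$. Assume that there are measurable functions $\tau_l:X\to\mathbb{N}_0$ such that $\mu(A_l)\,\tau_l\to0$ in $\nu_l$-probability as $l\to\infty$ (i.e. $\nu_l(\mu(A_l)\tau_l>\varepsilon)\to0$ for every $\varepsilon>0$), and $\nu_l(\tau_l<\varphi_{A_l})\to1$ as $l\to\infty$, while there is some compact subset $\mathfrak{K}$ of $(\mathfrak{P},d_{\mathfrak{P}})$ such that $T^{\tau_l}_\ast\nu_l\in\mathfrak{K}$ for all $l\geq1$. Then, for any random element $\Phi$ of $[0,\infty]^{\mathbb{N}_0}$, $$\mu(A_l)\Phi_{A_l}\overset{\nu_l}{\Longrightarrow}\Phi \quad\text{iff}\quad \mu(A_l)\Phi_{A_l}\overset{\mu}{\Longrightarrow}\Phi\qquad\text{as } l\to\infty.$$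
   Context: $(X,\mathcal{A},\mu)$ is a probability space and $T:X\to X$ an ergodic $\mu$-preserving map. For $A\in\mathcal{A}$ with $\mu(A)>0$: $\varphi_A(x):=\inf\{n\geq1:T^nx\in A\}$ (first hitting time), $T_Ax:=T^{\varphi_A(x)}x$ (first entrance map), $\mu_A(B):=\mu(A\cap B)/\mu(A)$. A sequence $(A_l)$ in $\mathcal{A}$ is asymptotically rare if $0<\mu(A_l)\to0$. $\mathfrak{P}$ is the set of probability measures $\nu$ on $(X,\mathcal{A})$ with $\nu\ll\mu$, with total variation distance $d_{\mathfrak{P}}(\nu,\nu'):=2\sup_{A\in\mathcal{A}}|\nu(A)-\nu'(A)|$. For measurable $\tau:X\to\mathbb{N}_0$, $T^\tau x:=T^{\tau(x)}x$ and $T^\tau_\ast\nu:=\nu\circ(T^\tau)^{-1}$. The hitting-time process is $\Phi_A:=(\varphi_A,\varphi_A\circ T_A,\varphi_A\circ T_A^2,\ldots):X\to[0,\infty]^{\mathbb{N}_0}$, where $[0,\infty]$ carries the metric $d(s,t)=|e^{-s}-e^{-t}|$ and $[0,\infty]^{\mathbb{N}_0}$ the product metric $\sum_{j\ge0}2^{-(j+1)}d(s^{(j)},t^{(j)})$. For measurable maps $R_l$ into a compact metric space and probabilities $\nu_l$, $R_l\overset{\nu_l}{\Longrightarrow}R$ means that the laws $\nu_l\circ R_l^{-1}$ converge weakly to the law of $R$. *)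

(* Defs.v *)
From HB Require Import structures.
From mathcomp Require Import all_boot all_order all_algebra.
From mathcomp Require Import all_classical all_reals all_analysis measurable_realfun.
Set Implicit Arguments. Unset Strict Implicit. Unset Printing Implicit Defensive.
Import Order.TTheory GRing.Theory Num.Theory.
Import numFieldNormedType.Exports.
Local Open Scope classical_set_scope.
Local Open Scope ring_scope.

Section Defs.
Context {d : measure_display} {X : measurableType d} {R : realType}.

Definition measure_preserving (mu : set X -> \bar R) (T : X -> X) : Prop :=
  measurable_fun setT T /\
  forall A, measurable A -> mu (T @^-1` A) = mu A.

Definition ergodic (mu : set X -> \bar R) (T : X -> X) : Prop :=
  forall A, measurable A -> T @^-1` A = A -> mu A = 0%E \/ mu A = 1%E.

Definition hit_times (T : X -> X) (A : set X) (x : X) : set nat :=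
  [set n | (0 < n)%N /\ A (iter n T x)].

(* first hitting time phi_A(x) = inf {n >= 1 : T^n x \in A}, in [1,+oo] (inf set0 = +oo) *)
Definition hit (T : X -> X) (A : set X) (x : X) : \bar R :=
  ereal_inf [set (n%:R)%:E | n in hit_times T A x].

(* first entrance map T_A x = T^{phi_A(x)} x  (convention: x itself when phi_A(x) = +oo,
   which happens only on a mu-null set) *)
Definition entrance (T : X -> X) (A : set X) (x : X) : X :=
  iter (xget 0%N [set n | hit_times T A x n /\ forall m, hit_times T A x m -> (n <= m)%N]) T x.

Definition hit_process (T : X -> X) (A : set X) (x : X) : nat -> \bar R :=
  fun j => hit T A (iter j (entrance T A) x).

Definition Pfrak (mu : set X -> \bar R) : set (probability X R) :=
  [set nu | forall A, measurable A -> mu A = 0%E -> nu A = 0%E].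

Definition dP (nu nu' : probability X R) : R :=
  2 * sup [set `|fine (nu A) - fine (nu' A)| | A in measurable].

Definition dP_open (mu : set X -> \bar R) (U : set (probability X R)) : Prop :=
  U `<=` Pfrak mu /\
  forall nu, U nu -> exists2 e : R, 0 < e &
    forall nu', Pfrak mu nu' -> dP nu nu' < e -> U nu'.

Definition dP_compact (mu : set X -> \bar R) (K : set (probability X R)) : Prop :=
  K `<=` Pfrak mu /\
  forall (I : Type) (U : I -> set (probability X R)),
    (forall i, dP_open mu (U i)) -> K `<=` \bigcup_i U i ->
    exists2 F : set I, finite_set F & K `<=` \bigcup_(i in F) U i.

End Defs.

Section Seqspace.
Context {R : realType}.

(* e^{-s} on [0,+oo] (e^{-oo} := 0); the value at -oo is irrelevant *)
Definition emexp (s : \bar R) : R :=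
  match s with EFin r => expR (- r) | _ => 0 end.

Definition dbar (s t : \bar R) : R := `|emexp s - emexp t|.

Definition seqspace : set (nat -> \bar R) := [set x | forall j, (0 <= x j)%E].

Definition dseq (x y : nat -> \bar R) : R :=
  limn (fun n => \sum_(0 <= j < n) ((2 ^+ j.+1)^-1 * dbar (x j) (y j))).

Definition bcont (f : (nat -> \bar R) -> R) : Prop :=
  (exists M : R, forall x, seqspace x -> `|f x| <= M) /\
  forall x, seqspace x -> forall e : R, 0 < e -> exists2 del : R, 0 < del &
    forall y, seqspace y -> dseq x y < del -> `|f x - f y| < e.
End Seqspace.

(* R_l =(nu_l)=> Phi : the laws nu_l o R_l^{-1} converge weakly to the law P o Phi^{-1},
   tested against bounded continuous functions (integrals written via the laws'
   pushforward, i.e. int f d(nu o R^{-1}) = int (f o R) d nu). *)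
Definition weak_conv {d : measure_display} {X : measurableType d} {R : realType}
  (nus : nat -> probability X R) (Rl : nat -> X -> nat -> \bar R)
  {d' : measure_display} {Om : measurableType d'} (P : probability Om R)
  (Phi : Om -> nat -> \bar R) : Prop :=
  forall f : (nat -> \bar R) -> R, bcont f ->
    ((fun l => \int[nus l]_x (f (Rl l x))%:E) @ \oo --> \int[P]_w (f (Phi w))%:E)%E.

(* Main.v *)
Require Import Defs.
From HB Require Import structures.
From mathcomp Require Import all_boot all_order all_algebra.
From mathcomp Require Import all_classical all_reals all_analysis measurable_realfun.
From mathcomp Require Import ring lra.
Set Implicit Arguments. Unset Strict Implicit. Unset Printing Implicit Defensive.
Import Order.TTheory GRing.Theory Num.Theory.
Import numFieldNormedType.Exports.
Local Open Scope classical_set_scope.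
Local Open Scope ring_scope.

(** For a bounded continuous [f] put [g_l := f (mu(A_l) Phi_(A_l))]; both
    implications follow once [int g_l dnu_l - int g_l dmu] tends to [0].

    If [n < phi_A x], then passing from [x] to [T^n x] only lowers the first
    hitting time by [n].  As [f] is uniformly continuous (the sequence space is
    compact), this gives [g_l o T^(tau_l) - g_l -> 0] in [L^1(nu_l)] and
    [g_l o T - g_l -> 0] in [L^1(mu)].  The first fact replaces [nu_l] by
    [rho_l := T^(tau_l)_* nu_l], an element of [K].

    For bounded [v], invariance of [mu] and the second fact give
    [int g_l v = int (g_l v) o T^k ~ int g_l (v o T^k)]; averaging over [k], the
    mean ergodic theorem yields [int g_l v - int g_l * int v -> 0].  Truncating
    densities, [int g_l drho - int g_l dmu -> 0] for each [rho << mu], and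
    uniformly on [K] since these functionals are equi-Lipschitz for the total
    variation distance.

    The mean ergodic theorem for bounded functions comes from the maximal
    ergodic lemma: if [int h < 0], the set where the Birkhoff sums of [h] are
    unbounded above is invariant and cannot have full measure. *)

(** * Bounded measurable functions and ergodic averages *)

Section BoundedMeasurable.
Context {d : measure_display} {X : measurableType d} {R : realType}.
Implicit Types (g h : X -> R) (nu : probability X R).

(** The bound holds at every point, so such functions are integrable for every probability measure
    at once: [mu], the [nu l] and the elements of [K]. *)
Definition bounded_measurable g : Prop :=
  measurable_fun setT g /\ exists M : R, forall x, `|g x| <= M.

Lemma bmE g (M : R) : measurable_fun setT g -> (forall x, `|g x| <= M) ->
  bounded_measurable g.
Proof. by move=> mg gM; split=> //; exists M. Qed.

Lemma bm_cst (c : R) : bounded_measurable (fun _ => c).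
Proof. by apply: (bmE (M := `|c|)). Qed.

Lemma bmD {g h} : bounded_measurable g -> bounded_measurable h ->
  bounded_measurable (fun x => g x + h x).
Proof.
move=> [mg [M gM]] [mh [N hN]]; apply: (bmE (M := M + N)).
  exact: measurable_funD.
by move=> x; rewrite (le_trans (ler_normD _ _))// lerD.
Qed.

Lemma bmN {g} : bounded_measurable g -> bounded_measurable (fun x => - g x).
Proof.
move=> [mg [M gM]]; apply: (bmE (M := M)); first exact: measurable_funN.
by move=> x; rewrite normrN.
Qed.

Lemma bmB {g h} : bounded_measurable g -> bounded_measurable h ->
  bounded_measurable (fun x => g x - h x).
Proof. by move=> bg bh; exact: bmD bg (bmN bh). Qed.

Lemma bmM {g h} : bounded_measurable g -> bounded_measurable h ->
  bounded_measurable (fun x => g x * h x).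
Proof.
move=> [mg [M gM]] [mh [N hN]]; apply: (bmE (M := M * N)).
  exact: measurable_funM.
by move=> x; rewrite normrM ler_pM.
Qed.

Lemma bmZ (c : R) {g} : bounded_measurable g ->
  bounded_measurable (fun x => c * g x).
Proof. by move=> bg; exact: bmM (bm_cst c) bg. Qed.

Lemma bm_norm {g} : bounded_measurable g -> bounded_measurable (fun x => `|g x|).
Proof.
move=> [mg [M gM]]; apply: (bmE (M := M)); first exact: measurableT_comp.
by move=> x; rewrite normr_id.
Qed.

Lemma bm_max0 {g} : bounded_measurable g ->
  bounded_measurable (fun x => Num.max 0 (g x)).
Proof.
move=> [mg [M gM]]; apply: (bmE (M := M)); first exact: measurable_maxr.
move=> x; have := gM x; rewrite maxEge; case: ifP => // _; rewrite normr0.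
exact: le_trans.
Qed.

Lemma bm_indic (B : set X) : measurable B -> bounded_measurable (\1_B : X -> R).
Proof.
move=> mB; apply: (bmE (M := 1)); first exact: measurable_indic.
by move=> x; rewrite indicE; case: (_ \in _); rewrite ?normr0 ?normr1.
Qed.

Lemma bm_integrable nu {g} : bounded_measurable g ->
  nu.-integrable setT (EFin \o g).
Proof.
move=> [mg [M gM]]; apply: measurable_bounded_integrable => //.
  by rewrite [ltLHS]probability_setT ltry.
exists M; split; first exact: num_real.
by move=> N MN x _ /=; rewrite (le_trans (gM x))// ltW.
Qed.

Lemma mean_cst nu (c : R) : \int[nu]_x c = c.
Proof. by rewrite Rintegral_cst// [X in fine X]probability_setT mulr1. Qed.

Lemma meanD nu {g h} : bounded_measurable g -> bounded_measurable h ->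
  \int[nu]_x (g x + h x) = \int[nu]_x g x + \int[nu]_x h x.
Proof. by move=> bg bh; rewrite RintegralD//; exact: bm_integrable. Qed.

Lemma meanB nu {g h} : bounded_measurable g -> bounded_measurable h ->
  \int[nu]_x (g x - h x) = \int[nu]_x g x - \int[nu]_x h x.
Proof. by move=> bg bh; rewrite RintegralB//; exact: bm_integrable. Qed.

Lemma meanZ nu (c : R) {g} : bounded_measurable g ->
  \int[nu]_x (c * g x) = c * \int[nu]_x g x.
Proof. by move=> bg; rewrite RintegralZl//; exact: bm_integrable. Qed.

Lemma le_mean nu {g h} : bounded_measurable g -> bounded_measurable h ->
  (forall x, g x <= h x) -> \int[nu]_x g x <= \int[nu]_x h x.
Proof.
by move=> bg bh gh; apply: le_Rintegral => //; exact: bm_integrable.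
Qed.

Lemma le_norm_mean nu {g} : bounded_measurable g ->
  `|\int[nu]_x g x| <= \int[nu]_x `|g x|.
Proof. by move=> bg; apply: le_normr_Rintegral => //; exact: bm_integrable. Qed.

Lemma le_norm_meanB nu {g h} :
  bounded_measurable g -> bounded_measurable h ->
  `|\int[nu]_x g x - \int[nu]_x h x| <= \int[nu]_x `|g x - h x|.
Proof.
by move=> bg bh; rewrite -meanB//; exact/le_norm_mean/bmB.
Qed.

Lemma norm_mean_le nu {g} (M : R) : measurable_fun setT g ->
  (forall x, `|g x| <= M) -> `|\int[nu]_x g x| <= M.
Proof.
move=> mg gM; have bg := bmE mg gM.
rewrite (le_trans (le_norm_mean nu bg))//.
rewrite -[leRHS](mean_cst nu); apply: le_mean => //.
- exact: bm_norm.
- exact: bm_cst.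
Qed.

Lemma mean_indic nu (B : set X) : measurable B ->
  \int[nu]_x \1_B x = fine (nu B).
Proof. by move=> mB; rewrite /Rintegral integral_indic// setIT. Qed.

End BoundedMeasurable.

(** * Integration along a measurable map *)

Section ChangeOfVariables.
Context {d d' : measure_display} {X : measurableType d} {Y : measurableType d'}.
Context {R : realType}.
Variables (phi : Y -> X) (g : X -> R).
Hypotheses (mphi : measurable_fun setT phi) (bg : bounded_measurable g).

Lemma bm_comp : bounded_measurable (fun y => g (phi y)).
Proof.
by have [mg [M gM]] := bg; apply: (bmE (M := M)) => //; exact: measurableT_comp.
Qed.

(** The image measure is known only through its values on measurable sets, which determine the
    integral. *)
Lemma mean_pushforward (rho : probability X R) (nu : probability Y R) :
  (forall B, measurable B -> rho B = nu (phi @^-1` B)) ->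
  \int[rho]_x g x = \int[nu]_y g (phi y).
Proof.
move=> rhoE; rewrite /Rintegral.
rewrite (eq_measure_integral (pushforward nu phi)); last first.
  by move=> B mB _; exact: rhoE.
rewrite integral_pushforward//; first by apply/measurable_EFinP; case: bg.
by rewrite preimage_setT; exact: (bm_integrable nu bm_comp).
Qed.

End ChangeOfVariables.

Lemma measurable_iter {d : measure_display} {X : measurableType d} (T : X -> X) n :
  measurable_fun setT T -> measurable_fun setT (iter n T).
Proof.
move=> mT; elim: n => [|n IH]; first exact: measurable_id.
by apply: (measurableT_comp (f := T)).
Qed.

(** * Maximal ergodic lemma and mean ergodic theorem *)

Section ErgodicAverages.
Context {d : measure_display} {X : measurableType d} {R : realType}.
Variables (mu : probability X R) (T : X -> X).
Hypothesis hT : measure_preserving mu T.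
Hypothesis hE : ergodic mu T.
Implicit Types (g h v : X -> R).

Let mT : measurable_fun setT T. Proof. by case: hT. Qed.

Lemma bm_iter n {g} : bounded_measurable g ->
  bounded_measurable (fun x => g (iter n T x)).
Proof. exact: bm_comp (measurable_iter n mT). Qed.

Lemma mean_iter n {g} : bounded_measurable g ->
  \int[mu]_x g (iter n T x) = \int[mu]_x g x.
Proof.
move=> bg; elim: n => [//|n IH]; rewrite -IH.
rewrite [RHS](mean_pushforward mT (bm_iter n bg) (nu := mu)); last first.
  by move=> B mB; case: hT => _ /(_ _ mB).
by apply: eq_Rintegral => x _; rewrite -iterSr.
Qed.

(* The maximum of [0, S_1 h, ..., S_n h], with [S_k h] the Birkhoff sums. *)
Fixpoint max_sum h n : X -> R :=
  if n is n'.+1 then fun x => Num.max 0 (h x + max_sum h n' (T x))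
  else fun _ => 0.

Lemma max_sum_ge0 h n x : 0 <= max_sum h n x.
Proof. by case: n => //= n; rewrite le_max lexx. Qed.

Lemma max_sum_nd h n x : max_sum h n x <= max_sum h n.+1 x.
Proof.
elim: n x => [|n IH] x; first exact: max_sum_ge0.
rewrite [leLHS]/= [leRHS]/= ge_max !le_max lexx /=; apply/orP; right.
by rewrite lerD2l; exact: IH.
Qed.

Lemma bm_max_sum h n : bounded_measurable h -> bounded_measurable (max_sum h n).
Proof.
move=> bh; elim: n => [|n IH]; first exact: bm_cst.
by apply: bm_max0; apply: bmD => //; exact: (bm_comp mT).
Qed.

Definition max_sum_pos h n : set X := [set x | 0 < max_sum h n x].

(** Unboundedness is insensitive to a bounded shift, so this set is strictly [T]-invariant, as
    [ergodic] demands. *)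
Definition max_sum_unbounded h : set X :=
  [set x | forall k : nat, exists n, k%:R < max_sum h n x].

Lemma measurable_max_sum_gt h n (c : R) : bounded_measurable h ->
  measurable [set x | c < max_sum h n x].
Proof.
move=> bh; have [mM _] := bm_max_sum n bh.
have := measurable_fun_ltr (measurable_cst c : measurable_fun setT _) mM.
move=> /(_ measurableT [set true]) /=; rewrite setTI; exact.
Qed.

Lemma measurable_max_sum_unbounded h : bounded_measurable h ->
  measurable (max_sum_unbounded h).
Proof.
move=> bh; rewrite (_ : max_sum_unbounded h =
    \bigcap_k \bigcup_n [set x | k%:R < max_sum h n x]).
  apply: bigcapT_measurable => k; apply: bigcupT_measurable => n.
  exact: measurable_max_sum_gt.
apply/seteqP; split=> x /=.
- by move=> Ex k _; have [n ?] := Ex k; exists n.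
- by move=> Ex k; have [n _ ?] := Ex k I; exists n.
Qed.

(* Garsia's argument: on [{max_sum h n.+1 > 0}] one has
   [h = max_sum h n.+1 - max_sum h n \o T]. *)
Lemma maximal_ergodic h n : bounded_measurable h ->
  0 <= \int[mu]_x (h x * \1_(max_sum_pos h n) x).
Proof.
move=> bh; case: n => [|n].
  apply: Rintegral_ge0 => x _; rewrite indicE memNset ?mulr0//.
  by rewrite /max_sum_pos /= ltxx.
have bM k := bm_max_sum k bh.
have bMT : bounded_measurable (fun x => max_sum h n (T x)).
  exact: (bm_comp mT).
have -> : 0 = \int[mu]_x max_sum h n x - \int[mu]_x max_sum h n (T x).
  by rewrite (mean_iter 1)// subrr.
apply: (@le_trans _ _ (\int[mu]_x max_sum h n.+1 x -
                       \int[mu]_x max_sum h n (T x))).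
  by rewrite lerB// le_mean// => x; exact: max_sum_nd.
rewrite -meanB//; apply: le_mean.
- exact: bmB.
- by apply: bmM => //; apply: bm_indic; exact: measurable_max_sum_gt.
move=> x; rewrite indicE; have [p|p] := ltP 0 (max_sum h n.+1 x).
  rewrite mem_set// mulr1 lerBlDr; move: p => /=.
  by rewrite lt_max ltxx /= => p; rewrite ge_max lexx ltW.
rewrite memNset; last by apply/negP; rewrite -leNgt.
rewrite mulr0 (le_anti (introT andP (conj p (max_sum_ge0 _ _ _)))) sub0r oppr_le0.
exact: max_sum_ge0.
Qed.

(** Ergodicity leaves measure 0 or 1. With measure 1 the sets [max_sum_pos h n] would increase to
    full measure, and the integrals of [h] over them, nonnegative by [maximal_ergodic], would tend
    to the negative mean of [h]. *)
Lemma max_sum_unbounded_null h : bounded_measurable h -> \int[mu]_x h x < 0 ->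
  mu (max_sum_unbounded h) = 0%E.
Proof.
move=> bh h0; set E := max_sum_unbounded h.
have mE : measurable E by exact: measurable_max_sum_unbounded.
have [_ [B hB]] := bh.
have invE : T @^-1` E = E.
  apply/seteqP; split=> x /= Ex k.
  (* Large maxima at [x] and at [T x] differ by the term [h x] up to a change of index; raising the
     threshold by an integer above [|B| + 1] absorbs it. *)
  - have [n] := Ex (k + Num.truncn (`|B| + 1)).+1%N.
    move=> kn; exists n.+1; rewrite /= lt_max; apply/orP; right.
    have : `|B| + 1 < (Num.truncn (`|B| + 1)).+1%:R by exact: truncnS_gt.
    have := hB x; have := ler_norm (- h x); rewrite normrN.
    have := ler_norm B; move: kn; rewrite -natr1 natrD -natr1; lra.
  - have [n] := Ex (k + Num.truncn (`|B| + 1)).+1%N.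
    case: n => [|n]; first by rewrite /= ltNge ler0n.
    rewrite /= lt_max ltNge ler0n /= => kn; exists n.
    have : `|B| + 1 < (Num.truncn (`|B| + 1)).+1%:R by exact: truncnS_gt.
    have := hB x; have := ler_norm (h x).
    have := ler_norm B; move: kn; rewrite -natr1 natrD -natr1; lra.
have [//|E1] := hE mE invE; exfalso.
have mP n : measurable (max_sum_pos h n) by exact: measurable_max_sum_gt.
have ndP : nondecreasing_seq (max_sum_pos h).
  apply/nondecreasing_seqP => n; rewrite subsetEset => x /= p.
  exact: lt_le_trans p (max_sum_nd _ _ _).
have U1 : mu (\bigcup_n max_sum_pos h n) = 1%E.
  apply/eqP; rewrite eq_le probability_le1 /=; last exact: bigcupT_measurable.
  rewrite -E1; apply: le_measure; rewrite ?inE//; first exact: bigcupT_measurable.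
  by move=> x /(_ 0) [n p]; exists n.
have : mu \o max_sum_pos h @ \oo --> 1%E.
  by rewrite -U1; apply: nondecreasing_cvg_mu => //; exact: bigcupT_measurable.
move=> /fine_cvgP[_ /cvgrPdist_lt].
(* Chosen so that removing a set of measure below [e] changes the integral of [h] by less than minus
   its mean, which keeps the remaining integral negative. *)
pose e := - (\int[mu]_x h x) / (`|B| + 1).
have B0 : 0 < `|B| + 1 by rewrite ltr_pwDr.
have e0 : 0 < e by rewrite /e divr_gt0// oppr_gt0.
move=> /(_ _ e0) [n _ /(_ n (leqnn n))] /=.
move=> en.
have h1 : \int[mu]_x (h x * \1_(max_sum_pos h n) x) - \int[mu]_x h x
    <= (`|B| + 1) * (1 - fine (mu (max_sum_pos h n))).
  have bi := bm_indic (mP n).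
  have -> : 1 - fine (mu (max_sum_pos h n)) = \int[mu]_x (1 - \1_(max_sum_pos h n) x).
    by rewrite meanB ?mean_cst ?mean_indic//; exact: bm_cst.
  rewrite -meanZ; last by apply: bmB => //; exact: bm_cst.
  rewrite -meanB//; last exact: bmM.
  apply: le_mean.
  - by apply: bmB => //; exact: bmM.
  - by apply: bmZ; apply: bmB => //; exact: bm_cst.
  move=> x; have := hB x; have := ler_norm (- h x); rewrite normrN.
  have := ler_norm B; rewrite indicE; case: (_ \in _) => /=; lra.
have := maximal_ergodic n bh.
move: en; rewrite /e ltr_pdivlMr// => en h2.
have := ler_norm (1 - fine (mu (max_sum_pos h n))).
rewrite -(ler_pM2l B0) => h3; move: h1 h2 h3 en; rewrite [`|1 - _| * _]mulrC; lra.
Qed.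

Definition birkhoff_sum v n x : R := \sum_(k < n) v (iter k T x).

Lemma birkhoff_sumS v n x :
  birkhoff_sum v n.+1 x = v x + birkhoff_sum v n (T x).
Proof.
rewrite /birkhoff_sum big_ord_recl /=; congr (_ + _).
by apply: eq_bigr => k _; rewrite -iterSr.
Qed.

Lemma birkhoff_sum_le_max h n x : birkhoff_sum h n x <= max_sum h n x.
Proof.
elim: n x => [|n IH] x; first by rewrite /birkhoff_sum big_ord0.
by rewrite birkhoff_sumS /= le_max lerD2l IH orbT.
Qed.

Lemma bm_birkhoff_sum v n : bounded_measurable v ->
  bounded_measurable (birkhoff_sum v n).
Proof.
move=> bv; elim: n => [|n IH].
  have -> : birkhoff_sum v 0 = fun=> 0; last exact: bm_cst.
  by apply/funext => x; rewrite /birkhoff_sum big_ord0.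
have -> : birkhoff_sum v n.+1 = fun x => birkhoff_sum v n x + v (iter n T x).
  by apply/funext => x; rewrite /birkhoff_sum big_ord_recr.
by apply: bmD => //; exact: bm_iter.
Qed.

Lemma mean_birkhoff_sum v n : bounded_measurable v ->
  \int[mu]_x birkhoff_sum v n x = n%:R * \int[mu]_x v x.
Proof.
move=> bv; elim: n => [|n IH].
  rewrite mul0r -[RHS](mean_cst mu); apply: eq_Rintegral => x _.
  by rewrite /birkhoff_sum big_ord0.
transitivity (\int[mu]_x (birkhoff_sum v n x + v (iter n T x))).
  by apply: eq_Rintegral => x _; rewrite /birkhoff_sum big_ord_recr.
rewrite meanD ?IH ?mean_iter ?mulrSl ?mulrDl ?mul1r//.
- by rewrite -natr1 mulrDl mul1r.
- exact: bm_birkhoff_sum.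
- exact: bm_iter.
Qed.

(** Since [h = v - e] has negative mean, its Birkhoff sums are bounded above at almost every point;
    after division by [n.+1] their positive part tends to 0, and dominated convergence applies. *)
Lemma birkhoff_average_pos v (e : R) : bounded_measurable v ->
  \int[mu]_x v x < e ->
  \int[mu]_x Num.max 0 (birkhoff_sum v n.+1 x / n.+1%:R - e) @[n --> \oo] --> 0.
Proof.
move=> bv ve.
have [mv [B vB]] := bv.
pose h x := v x - e.
have bh : bounded_measurable h by apply: bmB => //; exact: bm_cst.
have hsum n x : birkhoff_sum v n.+1 x / n.+1%:R - e = birkhoff_sum h n.+1 x / n.+1%:R.
  rewrite /birkhoff_sum sumrB mulrBl big_const_ord iter_addr_0 -[e *+ _]mulr_natr.
  by rewrite mulfK// pnatr_eq0.
pose f n x := Num.max 0 (birkhoff_sum v n.+1 x / n.+1%:R - e).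
have bf n : bounded_measurable (f n).
  apply: bm_max0; apply: bmB; last exact: bm_cst.
  by under eq_fun do rewrite mulrC; apply: bmZ; exact: bm_birkhoff_sum.
have hN := max_sum_unbounded_null bh.
have [] := @dominated_convergence _ _ _ mu setT measurableT
  (fun n x => (f n x)%:E) (cst 0%E) (cst (`|B| + `|e|)%:E).
- by move=> n; apply/measurable_EFinP; case: (bf n).
- exact: measurable_cst.
- exists (max_sum_unbounded h); split.
  + exact: measurable_max_sum_unbounded.
  + apply: hN; rewrite meanB//; last exact: bm_cst.
    by rewrite mean_cst subr_lt0.
  + move=> x /= nc; apply: contra_notP nc.
    move=> /existsNP[k /forallNP kM] _.
    apply/fine_cvgP; split; first exact: nearW.
    apply/cvgrPdist_lt => /= r r0; near=> n.
    rewrite sub0r normrN /f hsum ger0_norm; last by rewrite le_max lexx.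
    rewrite gt_max r0 /= ltr_pdivrMr ?ltr0n//.
    have := birkhoff_sum_le_max h n.+1 x; have := kM n.+1.
    move=> /negP; rewrite -leNgt => h1 h2.
    have : k%:R / r < n.+1%:R.
      apply: (@lt_trans _ _ n%:R); last by rewrite ltr_nat.
      by near: n; exact: nbhs_infty_gtr.
    by rewrite ltr_pdivrMr// mulrC; exact/le_lt_trans/(le_trans h2).
- by apply: (bm_integrable mu (g := cst _)); exact: bm_cst.
- apply: aeW => x n _ /=; rewrite lee_fin ger0_norm; last by rewrite le_max lexx.
  rewrite ge_max addr_ge0//=.
  have : birkhoff_sum v n.+1 x / n.+1%:R <= `|B|.
    rewrite ler_pdivrMr ?ltr0n// mulr_natr -[n.+1 in leRHS]card_ord -sumr_const.
    apply: ler_sum => k _; rewrite (le_trans (ler_norm _))//.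
    by rewrite (le_trans (vB _))// ler_norm.
  by move=> /lerD; apply; rewrite -normrN ler_norm.
move=> _ _; rewrite integral0 => /fine_cvgP[_].
exact.
Unshelve. all: end_near. Qed.

Lemma mean_ergodic v : bounded_measurable v ->
  \int[mu]_x `|birkhoff_sum v n.+1 x / n.+1%:R - \int[mu]_y v y|
    @[n --> \oo] --> 0.
Proof.
move=> bv; set c := \int[mu]_y v y.
apply/cvgrPdist_lt => /= e e0; near=> n.
rewrite sub0r normrN ger0_norm; last by apply: Rintegral_ge0.
(* Lowering the positive part by [e / 4] costs [e / 2] after doubling, and twice [e / 8] is [e / 4];
   the total [3 e / 4] stays below [e]. *)
have pe : \int[mu]_x Num.max 0 (birkhoff_sum v n.+1 x / n.+1%:R - (c + e / 4)) < e / 8.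
  near: n; have c4 : c < c + e / 4 by lra.
  have e8 : 0 < e / 8 by lra.
  have /cvgrPdist_lt/(_ _ e8) := birkhoff_average_pos bv c4.
  by apply: filterS => n; rewrite sub0r normrN => /(le_lt_trans (ler_norm _)).
pose a x := birkhoff_sum v n.+1 x / n.+1%:R.
have ba : bounded_measurable a.
  by rewrite /a; under eq_fun do rewrite mulrC; apply: bmZ; exact: bm_birkhoff_sum.
have ae : \int[mu]_x a x = c.
  rewrite /a; under eq_Rintegral do rewrite mulrC.
  rewrite meanZ ?mean_birkhoff_sum//; last exact: bm_birkhoff_sum.
  by rewrite mulKf// pnatr_eq0.
pose p x := Num.max 0 (a x - (c + e / 4)).
have bp : bounded_measurable p.
  by apply: bm_max0; apply: bmB => //; exact: bm_cst.
move: pe; rewrite -[X in X < _]/(\int[mu]_x p x).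
(* [|y| = 2 max 0 y - y], and [a - c] has mean zero. *)
have : \int[mu]_x `|a x - c| <= \int[mu]_x (2 * p x - (a x - c) + e / 2).
  have b1 : bounded_measurable (fun x => a x - c) by apply: bmB => //; exact: bm_cst.
  apply: le_mean.
  - exact: bm_norm.
  - by apply: bmD; [apply: bmB => //; exact: bmZ|exact: bm_cst].
  move=> x; rewrite /p.
  have [h1|h1] := leP 0 (a x - c).
    by rewrite (ger0_norm h1) maxEge; case: ifPn; rewrite -?ltNge => *; lra.
  have : 0 <= Num.max 0 (a x - (c + e / 4)) by rewrite le_max lexx.
  by rewrite (ltr0_norm h1); lra.
rewrite meanD; last 2 first.
- by apply: bmB; [exact: bmZ|apply: bmB => //; exact: bm_cst].
- exact: bm_cst.
rewrite meanB; last 2 first.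
- exact: bmZ.
- by apply: bmB => //; exact: bm_cst.
rewrite meanB//; last exact: bm_cst.
rewrite (meanZ mu 2 bp) !mean_cst ae /a; lra.
Unshelve. all: end_near. Qed.

End ErgodicAverages.

(** * Asymptotically invariant sequences *)

Section AsymptoticInvariance.
Context {d : measure_display} {X : measurableType d} {R : realType}.
Variables (mu : probability X R) (T : X -> X).
Hypothesis hT : measure_preserving mu T.
Hypothesis hE : ergodic mu T.
Implicit Types (g h v : X -> R).

(** The difference telescopes along the orbit, and by invariance each increment has the same
    mean. *)
Lemma mean_iterB g k : bounded_measurable g ->
  \int[mu]_x `|g (iter k T x) - g x| <= k%:R * \int[mu]_x `|g (T x) - g x|.
Proof.
move=> bg; have bgi n := bm_iter hT n bg.
elim: k => [|k IH].
  under eq_Rintegral do rewrite subrr normr0.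
  by rewrite mul0r mean_cst.
rewrite -natr1 mulrDl mul1r.
apply: (@le_trans _ _ (\int[mu]_x (`|g (iter k T x) - g x| +
                        `|g (T (iter k T x)) - g (iter k T x)|))).
  apply: le_mean.
  - by apply: bm_norm; exact: bmB (bgi k.+1) bg.
  - apply: bmD; first by apply: bm_norm; exact: bmB.
    by apply: bm_norm; exact: bmB (bgi k.+1) (bgi k).
  move=> x; rewrite [leRHS]addrC; apply: le_trans (ler_normD _ _).
  by rewrite addrA subrK.
have b1 : bounded_measurable (fun x => `|g (T x) - g x|).
  by apply: bm_norm; exact: bmB (bgi 1) bg.
rewrite meanD; first by rewrite lerD// (mean_iter hT k b1).
- by apply: bm_norm; exact: bmB.
- exact: (bm_iter hT k b1).
Qed.

(** Invariance turns the first integral into that of [(g v) o T^k]; what remains is [g o T^k - g]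
    weighted by a factor of size at most [N]. *)
Lemma meanM_iter g v (N : R) k : bounded_measurable g ->
  measurable_fun setT v -> (forall x, `|v x| <= N) ->
  `|\int[mu]_x (g x * v x) - \int[mu]_x (g x * v (iter k T x))|
    <= N * (k%:R * \int[mu]_x `|g (T x) - g x|).
Proof.
move=> bg mv vN; have bv := bmE mv vN.
have bgi n := bm_iter hT n bg; have bvi n := bm_iter hT n bv.
have N0 : 0 <= N by apply: le_trans (vN point); exact: normr_ge0.
rewrite -(mean_iter hT k (bmM bg bv)).
apply: le_trans (le_norm_meanB _ _ _) _ => /=.
- exact: bmM.
- exact: bmM.
apply: (@le_trans _ _ (N * \int[mu]_x `|g (iter k T x) - g x|)); last first.
  by rewrite ler_wpM2l// mean_iterB.
have b1 : bounded_measurable (fun x => `|g (iter k T x) - g x|).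
  by apply: bm_norm; exact: bmB.
rewrite -meanZ//; apply: le_mean.
- by apply: bm_norm; apply: bmB; exact: bmM.
- exact: bmZ.
by move=> x; rewrite -mulrBl normrM mulrC ler_wpM2r.
Qed.

(** Sums [meanM_iter] over the exponents below [n], each bounded crudely by its value at [n]. *)
Lemma meanM_birkhoff_sum g v (N : R) n : bounded_measurable g ->
  measurable_fun setT v -> (forall x, `|v x| <= N) ->
  `|n%:R * \int[mu]_x (g x * v x) - \int[mu]_x (g x * birkhoff_sum T v n x)|
    <= n%:R * (N * (n%:R * \int[mu]_x `|g (T x) - g x|)).
Proof.
move=> bg mv vN; have bv := bmE mv vN; set D := \int[mu]_x `|g (T x) - g x|.
have D0 : 0 <= D by apply: Rintegral_ge0.
have N0 : 0 <= N by apply: le_trans (vN point); exact: normr_ge0.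
have {}D0 : 0 <= N * D by exact: mulr_ge0.
elim: n => [|n IH].
  under [in X in _ - X]eq_Rintegral do rewrite /birkhoff_sum big_ord0 mulr0.
  by rewrite !mul0r mean_cst subr0 normr0.
have -> : \int[mu]_x (g x * birkhoff_sum T v n.+1 x) =
    \int[mu]_x (g x * birkhoff_sum T v n x) + \int[mu]_x (g x * v (iter n T x)).
  rewrite -meanD; last 2 first.
  - by apply: bmM => //; exact: (bm_birkhoff_sum hT).
  - by apply: bmM => //; exact: (bm_iter hT).
  by apply: eq_Rintegral => x _; rewrite /birkhoff_sum big_ord_recr mulrDr.
have := meanM_iter n bg mv vN; rewrite -/D => h.
rewrite -natr1 mulrDl mul1r opprD addrACA (le_trans (ler_normD _ _))//.
apply: le_trans (lerD IH h) _.
have n0 : 0 <= n%:R :> R by [].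
have nn : 0 <= (n%:R * (N * D)) by exact: mulr_ge0.
move: nn D0; nra.
Qed.

(* Averaging [meanM_iter] over [k <= n] replaces [v] by its Birkhoff average,
   which is close to a constant in L^1. *)
Lemma meanM_near g v (M N : R) n :
  measurable_fun setT g -> (forall x, `|g x| <= M) ->
  measurable_fun setT v -> (forall x, `|v x| <= N) ->
  `|\int[mu]_x (g x * v x) - (\int[mu]_x v x) * (\int[mu]_x g x)| <=
    N * (n.+1%:R * \int[mu]_x `|g (T x) - g x|) +
    M * \int[mu]_x `|birkhoff_sum T v n.+1 x / n.+1%:R - \int[mu]_y v y|.
Proof.
move=> mg gM mv vN; have bg := bmE mg gM; have bv := bmE mv vN.
set c := \int[mu]_y v y.
have M0 : 0 <= M by apply: le_trans (gM point); exact: normr_ge0.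
have bS := bm_birkhoff_sum hT n.+1 bv.
have bA : bounded_measurable (fun x => birkhoff_sum T v n.+1 x / n.+1%:R).
  by under eq_fun do rewrite mulrC; exact: bmZ.
apply: le_trans (ler_distD (\int[mu]_x (g x * (birkhoff_sum T v n.+1 x / n.+1%:R))) _ _) _.
apply: lerD.
  have -> : \int[mu]_x (g x * (birkhoff_sum T v n.+1 x / n.+1%:R)) =
            n.+1%:R^-1 * \int[mu]_x (g x * birkhoff_sum T v n.+1 x).
    rewrite -meanZ; last exact: bmM.
    by apply: eq_Rintegral => x _; rewrite mulrA mulrC.
  have n0 : 0 < n.+1%:R :> R by rewrite ltr0n.
  rewrite -(ler_pM2l n0) -[X in X * `|_|](ger0_norm (ltW n0)) -normrM mulrBr.
  rewrite mulVKf ?gt_eqF//; exact: meanM_birkhoff_sum.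
rewrite -(meanZ mu c bg).
apply: le_trans (le_norm_meanB _ _ _) _ => /=.
- exact: bmM.
- exact: bmZ.
have b1 : bounded_measurable
    (fun x => `|birkhoff_sum T v n.+1 x / n.+1%:R - c|).
  by apply: bm_norm; apply: bmB => //; exact: bm_cst.
rewrite -meanZ//; apply: le_mean.
- by apply: bm_norm; apply: bmB; [exact: bmM|exact: bmZ].
- exact: bmZ.
by move=> x; rewrite [c * _]mulrC -mulrBr normrM ler_wpM2r.
Qed.

Variables (g : nat -> X -> R) (M : R).
Hypothesis mg : forall l, measurable_fun setT (g l).
Hypothesis gM : forall l x, `|g l x| <= M.
Hypothesis gT : \int[mu]_x `|g l (T x) - g l x| @[l --> \oo] --> 0.

(** The order of choices matters: [n] is fixed first, to bring the Birkhoff average close to a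
    constant, and only then does [l] grow, which kills the other error in spite of its factor
    [n.+1]. *)
Lemma meanM_cvg v : bounded_measurable v ->
  \int[mu]_x (g l x * v x) - (\int[mu]_x v x) * (\int[mu]_x g l x)
    @[l --> \oo] --> 0.
Proof.
move=> bv; have [mv [N vN]] := bv.
have M0 : 0 <= M by apply: le_trans (gM 0 point); exact: normr_ge0.
have N0 : 0 <= N by apply: le_trans (vN point); exact: normr_ge0.
apply/cvgrPdist_lt => /= e e0.
have e1 : 0 < e / 2 / (M + 1) by rewrite !divr_gt0// ltr_wpDl.
have /cvgrPdist_lt/(_ _ e1)[n _ /(_ n (leqnn n))] /= := mean_ergodic hT hE bv.
rewrite sub0r normrN ltr_pdivlMr ?ltr_wpDl// => /(le_lt_trans _) hn.
near=> l; rewrite sub0r normrN.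
apply: le_lt_trans (meanM_near n (mg l) (gM l) mv vN) _.
have : \int[mu]_x `|g l (T x) - g l x| < e / 2 / (N * n.+1%:R + 1).
  near: l; have e2 : 0 < e / 2 / (N * n.+1%:R + 1).
    by rewrite !divr_gt0// ltr_wpDl// mulr_ge0.
  have /cvgrPdist_lt/(_ _ e2) := gT.
  by apply: filterS => l; rewrite sub0r normrN => /(le_lt_trans (ler_norm _)).
rewrite ltr_pdivlMr ?ltr_wpDl ?mulr_ge0// => h1.
set D := \int[mu]_x _ in h1 *; set B := \int[mu]_x `|_ - _| in hn *.
have D0 : 0 <= D by apply: Rintegral_ge0.
have B0 : 0 <= B by apply: Rintegral_ge0.
have {}hn : B * (M + 1) < e / 2 by apply: hn; rewrite ler_wpM2r ?ler_norm// addr_ge0.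
rewrite mulrDr mulr1 mulrC -mulrA in h1.
rewrite mulrDr mulr1 mulrC in hn.
lra.
Unshelve. all: end_near. Qed.

(** * Densities, truncation and total variation *)

(** The real-valued Radon-Nikodym derivative. Integrability of [h * u] is recorded because [u]
    itself may be unbounded. *)
Lemma density (rho : probability X R) : Pfrak mu rho ->
  exists2 u : X -> R, mu.-integrable setT (EFin \o u) &
    forall h, bounded_measurable h ->
      mu.-integrable setT (fun x => (h x * u x)%:E) /\
      \int[rho]_x h x = \int[mu]_x (h x * u x).
Proof.
move=> rhomu.
have dom : rho `<< mu.
  by move=> N N0 B mB BN; apply: rhomu => //; exact: N0.
pose u := Radon_Nikodym (charge_of_finite_measure rho) mu.
have ufin x : u x \is a fin_num by exact: Radon_Nikodym_fin_num.
have iu : mu.-integrable setT u by exact: Radon_Nikodym_integrable.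
have uE : EFin \o (fine \o u) = u by apply/funext => x /=; rewrite fineK.
exists (fine \o u); first by rewrite uE.
move=> h bh; have [mh [N hN]] := bh.
have huE : (fun x => (h x * (fine \o u) x)%:E) = (fun x => (h x)%:E * u x)%E.
  by apply/funext => x; rewrite EFinM /= fineK.
split.
  rewrite huE; have /integrableP[mu_ _] := iu.
  apply: (le_integrable measurableT _ _ (integrableZl measurableT N iu)).
    by apply: emeasurable_funM => //; exact/measurable_EFinP.
  move=> x _ /=; rewrite !abseM lee_wpmul2r// lee_fin.
  exact: le_trans (hN x) (ler_norm _).
rewrite /Rintegral huE; congr fine; apply/esym.
apply: Radon_Nikodym_change_of_variables => //.
exact: bm_integrable.
Qed.

Lemma measurable_norm_le (u : X -> R) (c : R) : measurable_fun setT u ->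
  measurable [set y | `|u y| <= c].
Proof.
move=> mu_; have mn : measurable_fun setT (fun y => `|u y|).
  exact: measurableT_comp.
have := measurable_fun_ler mn (measurable_cst c : measurable_fun setT _).
move=> /(_ measurableT [set true]) /=; rewrite setTI; exact.
Qed.

Lemma truncation_cvg (u : X -> R) : mu.-integrable setT (EFin \o u) ->
  \int[mu]_x `|u x - u x * \1_[set y | `|u y| <= n%:R] x| @[n --> \oo] --> 0.
Proof.
move=> iu; have mu_ : measurable_fun setT u.
  by apply/measurable_EFinP; case/integrableP : iu.
have mB (n : nat) : measurable [set y | `|u y| <= n%:R].
  exact: measurable_norm_le.
have mf (n : nat) : measurable_fun setT
    (fun x => `|u x - u x * \1_[set y | `|u y| <= n%:R] x|).
  apply: measurableT_comp => //; apply: measurable_funB => //.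
  by apply: measurable_funM => //; exact: measurable_indic.
have [] := @dominated_convergence _ _ _ mu setT measurableT
  (fun n x => `|u x - u x * \1_[set y | `|u y| <= n%:R] x|%:E)
  (cst 0%E) (fun x => `|u x|%:E).
- by move=> n; exact/measurable_EFinP.
- exact: measurable_cst.
- apply: aeW => x _; apply/fine_cvgP; split; first exact: nearW.
  apply: cvg_near_cst; near=> n => /=.
  rewrite indicE mem_set ?mulr1 ?subrr ?normr0//=.
  by near: n; exact: nbhs_infty_ger.
- exact: (integrable_norm iu).
- apply: aeW => x n _ /=; rewrite lee_fin normr_id indicE.
  by case: (_ \in _); rewrite ?mulr1 ?mulr0 ?subrr ?subr0 ?normr0.
by move=> _ _; rewrite integral0 => /fine_cvgP[_]; exact.
Unshelve. all: end_near. Qed.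

(** The density [u] is truncated to a bounded [v], to which [meanM_cvg] applies. The truncation
    error [D] enters twice: in replacing [u] by [v] against [g l], and because the mean of [v] need
    not be 1. Both are instances of [key], for [g l] and for the constant 1. *)
Lemma mean_Pfrak_cvg (rho : probability X R) : Pfrak mu rho ->
  \int[rho]_x g l x - \int[mu]_x g l x @[l --> \oo] --> 0.
Proof.
move=> /density[u iu uE].
have M0 : 0 <= M by apply: le_trans (gM 0 point); exact: normr_ge0.
have mu_ : measurable_fun setT u.
  by apply/measurable_EFinP; case/integrableP : iu.
apply/cvgrPdist_lt => /= e e0.
have e1 : 0 < e / 4 / (M + 1) by rewrite !divr_gt0// ltr_wpDl.
have /cvgrPdist_lt/(_ _ e1)[n _ /(_ n (leqnn n))] /= := truncation_cvg iu.
set B := [set y | _]; rewrite sub0r normrN => /(le_lt_trans (ler_norm _)) hn.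
have mB : measurable B by exact: measurable_norm_le.
pose v x := u x * \1_B x.
have bv : bounded_measurable v.
  apply: (bmE (M := n%:R)).
    by apply: measurable_funM => //; exact: measurable_indic.
  move=> x; rewrite /v indicE; have [xB|xB] := boolP (x \in B).
    by rewrite mulr1; exact: (set_mem xB).
  by rewrite mulr0 normr0.
set D := \int[mu]_x _ in hn.
rewrite ltr_pdivlMr ?ltr_wpDl// mulrDr mulr1 in hn.
have key h (N : R) : measurable_fun setT h -> (forall x, `|h x| <= N) ->
    `|\int[rho]_x h x - \int[mu]_x (h x * v x)| <= N * D.
  move=> mh hN; have bh := bmE mh hN.
  have [ihu ->] := uE _ bh.
  have iuv : mu.-integrable setT (EFin \o (fun x => `|u x - v x|)).
    apply: integrable_norm.
    have := integrableB measurableT iu (bm_integrable mu bv).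
    by apply: eq_integrable.
  have ihv := bm_integrable mu (bmM bh bv).
  rewrite -RintegralB//.
  have ihuv : mu.-integrable setT (EFin \o (fun x => h x * u x - h x * v x)).
    have := integrableB measurableT ihu ihv.
    by apply: eq_integrable.
  apply: le_trans (le_normr_Rintegral measurableT ihuv) _.
  rewrite -RintegralZl//; apply: le_Rintegral => //.
  - exact: integrable_norm.
  - have := integrableZl measurableT N iuv.
    by apply: eq_integrable.
  by move=> x _; rewrite -mulrBr normrM ler_wpM2r.
near=> l; rewrite sub0r normrN.
have k1 := key _ _ (mg l) (gM l).
have k2 : `|1 - \int[mu]_x v x| <= D.
  have := key (fun=> 1) 1 (measurable_cst _).
  rewrite mean_cst mul1r; under eq_Rintegral do rewrite mul1r.
  by apply => _; rewrite normr1.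
have k3 := norm_mean_le mu (mg l) (gM l).
have k4 : `|\int[mu]_x (g l x * v x) - (\int[mu]_x v x) * (\int[mu]_x g l x)| < e / 2.
  near: l; have e2 : 0 < e / 2 by lra.
  have /cvgrPdist_lt/(_ _ e2) := meanM_cvg bv.
  by apply: filterS => l; rewrite sub0r normrN.
have k5 : `|(1 - \int[mu]_x v x) * (\int[mu]_x g l x)| <= D * M.
  by rewrite normrM ler_pM.
have D0 : 0 <= D by apply: Rintegral_ge0.
set a := \int[rho]_x _ in k1 *; set b := \int[mu]_x (g l x * v x) in k1 k4 *.
set c := \int[mu]_x v x in k4 k5 *; set m := \int[mu]_x g l x in k4 k5 *.
have -> : a - m = (a - b) + (b - c * m) - (1 - c) * m by ring.
apply: le_lt_trans (ler_normB _ _) _.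
apply: le_lt_trans (lerD (ler_normD _ _) (lexx _)) _.
rewrite mulrC in k1; lra.
Unshelve. all: end_near. Qed.

(* The test set [u' <= u] of the densities realises the supremum in [dP]. *)
Lemma mean_dP (rho rho' : probability X R) h (N : R) :
  Pfrak mu rho -> Pfrak mu rho' ->
  measurable_fun setT h -> (forall x, `|h x| <= N) ->
  `|\int[rho]_x h x - \int[rho']_x h x| <= N * dP rho rho'.
Proof.
move=> /density[u iu uE] /density[u' iu' uE'] mh hN.
have bh := bmE mh hN.
have N0 : 0 <= N by apply: le_trans (hN point); exact: normr_ge0.
have meas w : mu.-integrable setT (EFin \o w) -> measurable_fun setT w.
  by move=> iw; apply/measurable_EFinP; case/integrableP : iw.
pose B := [set x | u' x <= u x].
have mB : measurable B.
  have := measurable_fun_ler (meas _ iu') (meas _ iu).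
  move=> /(_ measurableT [set true]) /=; rewrite setTI; exact.
have iB (w : X -> R) : mu.-integrable setT (fun x => (w x * u x)%:E) ->
    mu.-integrable setT (fun x => (w x * u' x)%:E) ->
    mu.-integrable setT (EFin \o (fun x => w x * (u x - u' x))).
  move=> i1 i2; have := integrableB measurableT i1 i2.
  by apply: eq_integrable => // x _; rewrite /= mulrBr EFinB.
have diff w : bounded_measurable w ->
    \int[rho]_x w x - \int[rho']_x w x = \int[mu]_x (w x * (u x - u' x)).
  move=> bw; have [i1 ->] := uE _ bw; have [i2 ->] := uE' _ bw.
  rewrite -RintegralB//; apply: eq_Rintegral => x _; by rewrite mulrBr.
have iw w : bounded_measurable w ->
    mu.-integrable setT (EFin \o (fun x => w x * (u x - u' x))).
  by move=> bw; apply: iB; [have [] := uE _ bw|have [] := uE' _ bw].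
(* The sign of [u - u']. Both measures have mass 1, so the constant [-1] cancels and
   [2 (rho B - rho' B)] remains, whence the factor 2 in [dP]. *)
pose s x : R := 2 * \1_B x - 1.
have bs : bounded_measurable s.
  by apply: bmB; [apply: bmZ; exact: bm_indic|exact: bm_cst].
have sE x : `|u x - u' x| = s x * (u x - u' x).
  rewrite /s indicE; have [xB|xB] := boolP (x \in B).
    by rewrite ger0_norm ?subr_ge0; [rewrite /=; lra|exact: (set_mem xB)].
  have : ~ B x by move=> /mem_set; rewrite (negbTE xB).
  rewrite /B /= => /negP; rewrite -ltNge => lt.
  by rewrite ltr0_norm ?subr_lt0//; lra.
have dPE : \int[mu]_x `|u x - u' x| <= dP rho rho'.
  under eq_Rintegral do rewrite sE.
  rewrite -diff// /s.
  have bi := bm_indic mB.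
  rewrite !meanB ?meanZ ?mean_cst ?mean_indic//; try exact: bmZ; try exact: bm_cst.
  rewrite opprB addrA addrNK -mulrBr /dP ler_pM2l//.
  apply: le_trans (ler_norm _) _; apply: ub_le_sup; last by exists B.
  exists 1 => _ [C mC <-].
  have p (nu : probability X R) : 0 <= fine (nu C) <= 1.
    by rewrite fine_ge0//= -lee_fin fineK ?fin_num_measure// probability_le1.
  have := p rho; have := p rho'; move=> /andP[? ?] /andP[? ?].
  by rewrite ler_norml; lra.
rewrite diff//; apply: le_trans (le_normr_Rintegral measurableT (iw _ bh)) _.
apply: le_trans (ler_wpM2l N0 dPE).
have i1 : mu.-integrable setT (EFin \o (fun x => `|u x - u' x|)).
  have := iw _ bs; apply: eq_integrable => // x _.
  by rewrite /= sE.
rewrite -RintegralZl//; apply: le_Rintegral => //.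
- exact: integrable_norm (iw _ bh).
- have := integrableZl measurableT N i1; by apply: eq_integrable.
by move=> x _; rewrite normrM ler_wpM2r.
Qed.

(** By [mean_Pfrak_cvg] every element of [K] lies in some [U n]. A finite subcover yields one index
    beyond which the error is below [e] on all of [K]. *)
Lemma mean_compact_cvg (K : set (probability X R)) (rho : nat -> probability X R) :
  dP_compact mu K -> (forall l, K (rho l)) ->
  \int[rho l]_x g l x - \int[mu]_x g l x @[l --> \oo] --> 0.
Proof.
move=> [KP cK] Krho; apply/cvgrPdist_lt => /= e e0.
have M0 : 0 <= M by apply: le_trans (gM 0 point); exact: normr_ge0.
pose D nu l := `|\int[nu]_x g l x - \int[mu]_x g l x|.
(* The margin [r] makes the sets [U n] open. *)
pose U (n : nat) := [set nu : probability X R | Pfrak mu nu /\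
  exists2 r : R, 0 < r & forall l, (n <= l)%N -> D nu l <= e - r].
have oU n : dP_open mu (U n).
  split; first by move=> nu [].
  (* By [mean_dP] a move of [dP]-length below this radius changes both the error by at most [r / 2]
     and the margin from [r] to [r / 2]. *)
  move=> nu [nuP [r r0 nur]]; exists (r / 2 / (M + 1)).
    by rewrite !divr_gt0// ltr_wpDl.
  move=> nu' nu'P; rewrite ltr_pdivlMr ?ltr_wpDl// => lt; split=> //.
  exists (r / 2); first lra.
  move=> l nl; have := nur l nl; rewrite /D.
  have := mean_dP nuP nu'P (mg l) (gM l).
  have dP0 : 0 <= dP nu nu'.
    have := @mean_dP _ _ (fun=> 1) 1 nuP nu'P (measurable_cst _).
    by rewrite !mean_cst subrr normr0 mul1r; apply=> _; rewrite normr1.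
  have := ler_distD (\int[nu]_x g l x) (\int[nu']_x g l x) (\int[mu]_x g l x).
  rewrite [`|\int[nu']_x g l x - \int[nu]_x g l x|]distrC.
  move: lt; rewrite mulrDr mulr1 [M * _]mulrC; lra.
have [|F finF KF] := cK _ U oU.
  move=> nu Knu; have e2 : 0 < e / 2 by lra.
  have /cvgrPdist_lt/(_ _ e2)[n _ nH] := mean_Pfrak_cvg (KP _ Knu).
  exists n => //; split; first exact: KP.
  exists (e / 2) => // l /nH /=; rewrite sub0r normrN /D; lra.
have [n Fn] : exists n, forall m, F m -> (m <= n)%N.
  have /finite_seqP[s ->] := finF.
  by exists (\max_(i <- s) i)%N => m ms; exact: leq_bigmax_seq.
near=> l; rewrite sub0r normrN.
have [m Fm [_ [r r0 mr]]] := KF _ (Krho l).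
have : D (rho l) l <= e - r.
  apply: mr; apply: leq_trans (Fn _ Fm) _; by near: l; exists n.
rewrite /D; lra.
Unshelve. all: end_near. Qed.

End AsymptoticInvariance.

(** * The sequence space *)

Section SequenceSpace.
Context {R : realType}.
Implicit Types (s t : \bar R) (x y : nat -> \bar R).

Lemma emexp_ge0 s : 0 <= emexp s.
Proof. by case: s => //= r; exact: expR_ge0. Qed.

Lemma emexp_le1 s : (0 <= s)%E -> emexp s <= 1.
Proof. by case: s => //= r; rewrite lee_fin -oppr_le0 expR_le1. Qed.

Lemma dbar_le1 s t : (0 <= s)%E -> (0 <= t)%E -> dbar s t <= 1.
Proof.
move=> s0 t0; have := emexp_ge0 s; have := emexp_ge0 t.
have := emexp_le1 s0; have := emexp_le1 t0.
by rewrite /dbar ler_norml; lra.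
Qed.

(** The weights of the first [N] coordinates sum to at most 1, and those of the remaining ones to
    [2^-N], where [dbar] is at most 1. *)
Lemma dseq_le x y (N : nat) (e : R) : seqspace x -> seqspace y -> 0 <= e ->
  (forall j, (j < N)%N -> dbar (x j) (y j) <= e) ->
  dseq x y <= e + (2 ^+ N)^-1.
Proof.
move=> x0 y0 e0 xye; rewrite /dseq; set S := fun n => _.
have SS n : S n.+1 = S n + (2 ^+ n.+1)^-1 * dbar (x n) (y n).
  by rewrite /S big_nat_recr.
have p0 n : 0 < (2 ^+ n)^-1 :> R by rewrite invr_gt0 exprn_gt0.
have pS n : (2 ^+ n.+1)^-1 = (2 ^+ n)^-1 / 2 :> R.
  by rewrite exprS invfM mulrC.
have ndS : nondecreasing_seq S.
  by apply/nondecreasing_seqP => n; rewrite SS lerDl mulr_ge0 ?normr_ge0// ltW.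
(* One invariant for both ranges: the second bracket is the tail weight used so far and vanishes
   while [n <= N]. *)
have bS n : S n <= e * (1 - (2 ^+ n)^-1) + ((2 ^+ N)^-1 - (2 ^+ maxn n N)^-1).
  elim: n => [|n IH].
    by rewrite /S big_nil max0n expr0 invr1 !subrr mulr0 addr0.
  rewrite SS; have := p0 n.+1; have := pS n; have [nN|Nn] := ltnP n N.
    move: IH; rewrite (maxn_idPr (ltnW nN)) (maxn_idPr nN) subrr !addr0 => IH pE q0.
    have : (2 ^+ n.+1)^-1 * dbar (x n) (y n) <= (2 ^+ n.+1)^-1 * e.
      by rewrite ler_pM2l// xye.
    nra.
  move: IH; rewrite (maxn_idPl Nn) (maxn_idPl (leqW Nn)) => IH pE q0.
  have : (2 ^+ n.+1)^-1 * dbar (x n) (y n) <= (2 ^+ n.+1)^-1 * 1.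
    by rewrite ler_pM2l// dbar_le1.
  have : 0 <= e * (2 ^+ n.+1)^-1 by rewrite mulr_ge0// ltW.
  nra.
have ubS n : S n <= e + (2 ^+ N)^-1.
  have := bS n; have := p0 (maxn n N); have := mulr_ge0 e0 (ltW (p0 n)); lra.
apply: limr_le; last exact: nearW.
by apply: nondecreasing_is_cvgn => //; exists (e + (2 ^+ N)^-1) => _ [n _ <-].
Qed.

Lemma half_expr_cvg (e : R) : 0 < e -> exists N, (2 ^+ N)^-1 < e.
Proof.
move=> e0; exists (Num.truncn e^-1).+1; rewrite invf_plt ?posrE ?exprn_gt0//.
apply: lt_le_trans (truncnS_gt _) _; rewrite -natrX ler_nat ltnW//.
exact: ltn_expl.
Qed.

Import ArrowAsProduct.

Lemma bcont_uniform (f : (nat -> \bar R) -> R) (e : R) : bcont f -> 0 < e ->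
  exists2 del : R, 0 < del & forall x y, seqspace x -> seqspace y ->
    (forall j, dbar (x j) (y j) <= del) -> `|f x - f y| < e.
Proof.
(* [emexp] embeds the space into the Tychonoff cube [[0, 1]^nat]; a cluster point
   of violating pairs contradicts continuity there. *)
move=> [_ cf] e0; apply: contrapT => H.
have /choice[xy xyP] : forall n : nat, exists xy : (nat -> \bar R) * (nat -> \bar R),
    [/\ seqspace xy.1, seqspace xy.2,
      forall j, dbar (xy.1 j) (xy.2 j) <= n.+1%:R^-1 & e <= `|f xy.1 - f xy.2|].
  move=> n; apply: contrapT => Hn; apply: H; exists n.+1%:R^-1 => //.
  move=> x y x0 y0 xy; rewrite ltNge; apply/negP => exy.
  by apply: Hn; exists (x, y).
pose p (n : nat) : nat -> R := fun j => emexp ((xy n).1 j).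
have cpt : compact [set q : nat -> R | forall i, `[0 : R, 1]%classic (q i)].
  apply: (@tychonoff nat (fun=> R : topologicalType) (fun=> `[0, 1]%classic)).
  by move=> _; exact: segment_compact.
have [|q [q01 clq]] := cpt (p @ \oo) (fmap_proper_filter p eventually_filter).
  exists 0%N => // n _ i /=; rewrite in_itv /= emexp_ge0 emexp_le1//.
  by have [h _ _ _] := xyP n; exact: h.
(* The inverse of [emexp], with 0 corresponding to [+oo]. *)
pose z j : \bar R := if q j == 0 then +oo%E else (- ln (q j))%:E.
have zq j : emexp (z j) = q j.
  rewrite /z; case: eqP => [->//|/eqP qj]; rewrite /= opprK lnK// posrE.
  by have := q01 j; rewrite /= in_itv /= lt_def qj => /andP[].
have z0 : seqspace z.
  move=> j; rewrite /z; case: eqP => // _; rewrite lee_fin oppr_ge0 ln_le0//.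
  by have := q01 j; rewrite /= in_itv /= => /andP[].
have [del del0 zdel] := cf z z0 (e / 2) ltac:(lra).
(* With [del / 4] on the first [N] coordinates and a tail below [del / 4], the first point of the
   pair is within [del / 2] of [z]; the second, a further [del / 4] away, is within [3 del / 4]. *)
have [N NP] : exists N, (2 ^+ N)^-1 < del / 4 by apply: half_expr_cvg; lra.
(* A product neighbourhood controls only finitely many coordinates, which is why the tail was cut at
   [N]. *)
have nV : nbhs q [set w : nat -> R | forall i : 'I_N, `|q i - w i| < del / 4].
  apply: (@filter_forall _ _ (fun (i : 'I_N) (w : nat -> R) => `|q i - w i| < del / 4) _ (nbhs_filter q)) => i.
  have := @proj_continuous nat (fun=> R : topologicalType) i q.
  move=> /cvgrPdist_lt; apply; lra.
have Fp : (p @ \oo) (p @` [set n | n.+1%:R^-1 < del / 4]).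
  have : \forall n \near \oo, n.+1%:R^-1 < del / 4.
    have d4 : 0 < del / 4 by lra.
    near=> n; rewrite invf_plt ?posrE//.
    apply: (@lt_trans _ _ n%:R); last by rewrite ltr_nat.
    by near: n; exact: nbhs_infty_gtr.
  by apply: filterS => n nd; exists n.
have [_ [[n /= nd <-] Vn]] := clq _ _ Fp nV.
have [x0 y0 xyn exy] := xyP n.
have dzx j : (j < N)%N -> dbar (z j) ((xy n).1 j) <= del / 4.
  by move=> jN; rewrite /dbar zq ltW//; exact: (Vn (Ordinal jN)).
have fx : `|f z - f (xy n).1| < e / 2.
  apply: zdel => //.
  by apply: le_lt_trans (dseq_le z0 x0 _ dzx) _; lra.
have fy : `|f z - f (xy n).2| < e / 2.
  apply: zdel => //.
  have dzy j : (j < N)%N -> dbar (z j) ((xy n).2 j) <= del / 2.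
    move=> jN; have := dzx j jN; have := le_trans (xyn j) (ltW nd); rewrite /dbar => h1 h2.
    apply: le_trans (ler_distD (emexp ((xy n).1 j)) _ _) _; lra.
  by apply: le_lt_trans (dseq_le z0 y0 _ dzy) _; lra.
have := ler_distD (f z) (f (xy n).1) (f (xy n).2).
rewrite [`|f (xy n).1 - f z|]distrC; lra.
Unshelve. all: end_near. Qed.

End SequenceSpace.

(** * Hitting times *)

Section CountableRange.
Context {d : measure_display} {X : measurableType d}.

(** The preimage of [S] is the countable union of the fibres over those [i] with [S (F i)]; the
    constant set in each intersection selects them. *)
Lemma measurable_countable_comp {d' : measure_display} {Y : measurableType d'}
    (I : countType) (t : X -> I) (F : I -> Y) :
  (forall i, measurable (t @^-1` [set i])) -> measurable_fun setT (F \o t).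
Proof.
move=> mt _ S mS; rewrite setTI.
rewrite (_ : _ @^-1` S = \bigcup_i (t @^-1` [set i] `&` [set _ | S (F i)])).
  apply: countable_bigcupT_measurable => [|i]; first exact: countableP.
  have [Si|nSi] := pselect (S (F i)).
    by rewrite (_ : [set _ | _] = setT) ?setIT//; apply/seteqP; split.
  by rewrite (_ : [set _ | _] = set0) ?setI0//; apply/seteqP; split.
apply/seteqP; split=> x /=; first by exists (t x).
by move=> [i _ [/= ->]].
Qed.

Lemma measurable_fiber (t : X -> nat) k : measurable_fun setT t ->
  measurable (t @^-1` [set k]).
Proof. by move=> mt; rewrite -[X in measurable X]setTI; exact: mt. Qed.

Lemma measurable_random_iter (T : X -> X) (s : X -> nat) :
  measurable_fun setT T -> measurable_fun setT s ->
  measurable_fun setT (fun x => iter (s x) T x).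
Proof.
move=> mT ms _ B mB; rewrite setTI.
rewrite (_ : _ @^-1` B = \bigcup_k (s @^-1` [set k] `&` iter k T @^-1` B)).
  apply: bigcupT_measurable => k; apply: measurableI.
    exact: measurable_fiber.
  by rewrite -[X in measurable X]setTI; exact: measurable_iter.
apply/seteqP; split=> x /=; first by exists (s x).
by move=> [k _ [/= ->]].
Qed.

End CountableRange.

Section FirstHit.
Context {d : measure_display} {X : measurableType d}.
Variables (T : X -> X) (A : set X).

(* [0] stands for "never": genuine hitting times are positive. *)
Definition first_hit (x : X) : nat :=
  xget 0%N [set n | hit_times T A x n /\
    forall m, hit_times T A x m -> (n <= m)%N].

Lemma entranceE x : entrance T A x = iter (first_hit x) T x.
Proof. by []. Qed.

Variant first_hit_spec x : nat -> Prop :=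
| FirstHitNever of (forall m, ~ hit_times T A x m) : first_hit_spec x 0
| FirstHitAt n of hit_times T A x n.+1 &
    (forall m, hit_times T A x m -> (n.+1 <= m)%N) : first_hit_spec x n.+1.

Lemma first_hitP x : first_hit_spec x (first_hit x).
Proof.
rewrite /first_hit; case: xgetP => [n _ [[n0 An] nmin]|H].
  by case: n n0 An nmin => // n n0 An nmin; exact: FirstHitAt.
apply: FirstHitNever => m hm.
have ex : exists n, `[< hit_times T A x n >] by exists m; apply/asboolP.
apply: (H (ex_minn ex)); case: ex_minnP => k /asboolP hk kmin.
by split=> // n hn; apply: kmin; apply/asboolP.
Qed.

Lemma first_hit_eq x n : hit_times T A x n ->
  (forall m, hit_times T A x m -> (n <= m)%N) -> first_hit x = n.
Proof.
move=> hn nmin; case: first_hitP => [/(_ n)//|k hk kmin].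
by apply/eqP; rewrite eqn_leq kmin// nmin.
Qed.

(** Decodes [first_hit], where 0 stands for a point that never hits. *)
Definition hit_value {R : realType} (k : nat) : \bar R :=
  if k == 0%N then +oo%E else (k%:R)%:E.

Lemma hitE {R : realType} x : hit T A x = hit_value (first_hit x) :> \bar R.
Proof.
rewrite /hit /hit_value; case: first_hitP => [H|n hn nmin] /=.
  rewrite (_ : hit_times T A x = set0) ?image_set0 ?ereal_inf0//.
  by apply/seteqP; split=> // m /H.
apply/eqP; rewrite eq_le; apply/andP; split.
  by apply: ereal_inf_lbound; exists n.+1.
by apply: le_ereal_inf_tmp => _ [m hm <-]; rewrite lee_fin ler_nat nmin.
Qed.

Lemma hit_value_ge0 {R : realType} k : (0 <= hit_value k :> \bar R)%E.
Proof. by rewrite /hit_value; case: eqP => // _; rewrite lee_fin. Qed.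

Hypotheses (mT : measurable_fun setT T) (mA : measurable A).

(** A positive fibre is a countable condition on the orbit: a visit at that time and none earlier.
    The fibre over 0 is what the positive ones leave. *)
Lemma measurable_first_hit : measurable_fun setT first_hit.
Proof.
have mi n B : measurable B -> measurable [set x | B (iter n T x)].
  move=> mB; rewrite -[X in measurable X]setTI.
  exact: (measurable_iter n mT measurableT).
have m1 n : measurable (first_hit @^-1` [set n.+1]).
  rewrite (_ : _ @^-1` _ = [set x | A (iter n.+1 T x)] `&`
     \bigcap_m [set x | (0 < m < n.+1)%N -> (~` A) (iter m T x)]).
    apply: measurableI; first exact: mi.
    apply: bigcapT_measurable => m; case: (0 < m < n.+1)%N.
      rewrite (_ : [set x | _] = [set x | (~` A) (iter m T x)]).
        by apply: mi; exact: measurableC.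
      by apply/seteqP; split=> x /= H; [exact: H|].
    by rewrite (_ : [set x | _] = setT)//; apply/seteqP; split.
  apply/seteqP; split=> x /=.
    case: first_hitP => // k [_ hk] kmin [<-]; split=> // m _ /= /andP[m0 mk] Am.
    by have := kmin m (conj m0 Am); rewrite leqNgt mk.
  move=> [An H]; apply: first_hit_eq => // m [m0 Am]; rewrite leqNgt.
  by apply/negP => mn; apply: (H m) => //; rewrite m0.
suff mf n : measurable (first_hit @^-1` [set n]).
  exact: (@measurable_countable_comp _ _ _ nat nat _ id mf).
case: n => //.
rewrite (_ : _ @^-1` _ = ~` \bigcup_n (first_hit @^-1` [set n.+1])).
  by apply: measurableC; exact: bigcupT_measurable.
apply/seteqP; split=> x /=; first by move=> x0 [n _] /=; rewrite x0.
by move=> H; case E: (first_hit x) => [//|n]; exfalso; apply: H; exists n.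
Qed.

Lemma measurable_entrance : measurable_fun setT (entrance T A).
Proof. exact: measurable_random_iter mT measurable_first_hit. Qed.

Lemma hit_times_iter x n m :
  (0 < m)%N -> hit_times T A (iter n T x) m <-> hit_times T A x (m + n)%N.
Proof. by move=> m0; rewrite /hit_times /= iterD addn_gt0 m0. Qed.

Lemma hit_processS {R : realType} x j :
  hit_process T A x j.+1 = hit_process T A (entrance T A x) j :> \bar R.
Proof. by rewrite /hit_process iterSr. Qed.

(** By convention [entrance] fixes a point that never hits, so every coordinate repeats the
    first. *)
Lemma hit_process_never {R : realType} x j : first_hit x = 0%N ->
  hit_process T A x j = +oo%E :> \bar R.
Proof.
move=> x0; elim: j => [|j IH]; first by rewrite /hit_process /= hitE x0.
by rewrite hit_processS entranceE x0.
Qed.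

Lemma hit_process_ge0 {R : realType} x j :
  (0 <= hit_process T A x j :> \bar R)%E.
Proof. by rewrite /hit_process hitE hit_value_ge0. Qed.

(** * The rescaled hitting-time process *)

Section Process.
Context {R : realType}.
Variable a : R.
Hypothesis a0 : 0 < a.

Definition scaled_process (x : X) : nat -> \bar R :=
  fun j => (a%:E * hit_process T A x j)%E.

Lemma scaled_process_seqspace x : seqspace (scaled_process x).
Proof. by move=> j; rewrite mule_ge0 ?lee_fin ?(ltW a0)// hit_process_ge0. Qed.

(** The map [exp(-.)] is 1-Lipschitz on nonnegative reals, from [1 + y <= exp y] at [y = t - s]. *)
Lemma dbar_fin_le (s t : R) : 0 <= t -> t <= s -> dbar s%:E t%:E <= s - t.
Proof.
move=> t0 ts; rewrite /dbar /= distrC ger0_norm; last first.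
  by rewrite subr_ge0 ler_expR lerN2.
have -> : - s = - t + (t - s) by ring.
rewrite expRD; have : expR (- t) <= 1 by rewrite expR_le1 oppr_le0.
have := expR_ge1Dx (t - s); have := expR_gt0 (- t); nra.
Qed.

(** Before the first hit, [x] and [T^n x] share their entrance point, so only coordinate 0 differs,
    by [a n]. If [x] never hits, neither does [T^n x], and both processes are constantly [+oo]. *)
Lemma scaled_process_iter x n j : ((n%:R : R)%:E < hit T A x)%E ->
  dbar (scaled_process x j) (scaled_process (iter n T x) j) <= a * n%:R.
Proof.
have an0 : 0 <= a * n%:R by rewrite mulr_ge0// ltW.
have dxx s : dbar s s <= a * n%:R by rewrite /dbar subrr normr0.
rewrite hitE /scaled_process; case Ex: (first_hit x) / (first_hitP x) => [H|m hm mmin].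
  move=> _; rewrite !hit_process_never//.
  case: first_hitP => // k hk; have /hit_times_iter -/(_ erefl) := hk.
  by move/H.
rewrite /hit_value /= lte_fin ltr_nat => nm.
have Ey : first_hit (iter n T x) = (m.+1 - n)%N.
  apply: first_hit_eq.
    have mn0 : (0 < m.+1 - n)%N by rewrite subn_gt0.
    by apply/(hit_times_iter _ _ mn0); rewrite subnK// ltnW.
  move=> k hk; rewrite leq_subLR addnC; apply: mmin.
  by apply/hit_times_iter => //; case: hk.
case: j => [|j].
  rewrite /hit_process /= !hitE Ex Ey /hit_value subn_eq0 leqNgt nm /=.
  apply: le_trans (dbar_fin_le _ _) _.
  - by rewrite mulr_ge0// ltW.
  - by rewrite ler_pM2l// ler_nat leq_subr.
  by rewrite -mulrBr natrB 1?ltnW// opprB addrCA subrr addr0.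
rewrite !hit_processS !entranceE Ex Ey -iterD subnK//; exact: ltnW.
Qed.

Lemma measurable_bcont_process (f : (nat -> \bar R) -> R) : bcont f ->
  measurable_fun setT (f \o scaled_process).
Proof.
move=> [_ cf].
(* Keeping only the first [n] coordinates leaves countably many values. *)
pose code n x := mkseq (fun j => first_hit (iter j (entrance T A) x)) n.
pose dec (s : seq nat) : nat -> \bar R := fun j =>
  if (j < size s)%N then (a%:E * hit_value (nth 0%N s j))%E else 0%E.
have dec0 s : seqspace (dec s).
  move=> j; rewrite /dec; case: ifP => // _.
  by rewrite mule_ge0 ?lee_fin ?(ltW a0)// hit_value_ge0.
have decE n x j : (j < n)%N -> dec (code n x) j = scaled_process x j.
  by move=> jn; rewrite /dec /code size_mkseq jn nth_mkseq// -hitE.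
(* Replacing the coordinates from [n] on by 0 moves a sequence by at most [2^-n] in [dseq], so
   continuity of [f] gives pointwise convergence. *)
apply: (@measurable_fun_cvg _ _ _ _ (fun n => (f \o dec) \o code n)).
  move=> n; apply: measurable_countable_comp => s.
  have [sn|sn] := eqVneq (size s) n; last first.
    rewrite (_ : _ @^-1` _ = set0)//; apply/seteqP; split=> // x /= xs.
    by move: sn; rewrite -xs size_mkseq eqxx.
  rewrite (_ : _ @^-1` _ = \bigcap_j [set x | (j < n)%N ->
      first_hit (iter j (entrance T A) x) = nth 0%N s j]).
    apply: bigcapT_measurable => j; case: (j < n)%N; last first.
      by rewrite (_ : [set x | _] = setT)//; apply/seteqP; split.
    rewrite (_ : [set x | _] =
        (first_hit \o iter j (entrance T A)) @^-1` [set nth 0%N s j]).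
      apply: measurable_fiber; apply: measurableT_comp.
        exact: measurable_first_hit.
      exact/measurable_iter/measurable_entrance.
    by apply/seteqP; split=> x /= H; [exact: H|].
  apply/seteqP; split=> x /=.
    by move=> <- j _ /= jn; rewrite nth_mkseq.
  move=> H; apply: (@eq_from_nth _ 0%N); rewrite size_mkseq// => j jn.
  by rewrite nth_mkseq// (H j).
move=> x _; apply/cvgrPdist_lt => /= e e0.
have [del del0 xdel] := cf _ (scaled_process_seqspace x) _ e0.
have [N NP] := half_expr_cvg del0.
exists N => // n /= Nn; apply: xdel => //.
apply: le_lt_trans NP; rewrite -[leRHS]add0r.
apply: dseq_le => // [|j jN]; first exact: scaled_process_seqspace.
by rewrite decE ?/dbar ?subrr ?normr0//; exact: leq_trans jN Nn.
Qed.

End Process.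

(** The event depends only on the pair of [s] and [first_hit], which has countable range. *)
Lemma measurable_lt_hit {R : realType} (s : X -> nat) : measurable_fun setT s ->
  measurable [set x | (((s x)%:R : R)%:E < hit T A x)%E].
Proof.
move=> ms; pose t x := (s x, first_hit x).
have mt i : measurable (t @^-1` [set i]).
  case: i => i j; rewrite (_ : _ @^-1` _ = s @^-1` [set i] `&` first_hit @^-1` [set j]).
    apply: measurableI; apply: measurable_fiber => //.
    exact: measurable_first_hit.
  by apply/seteqP; split=> x /= [<- <-].
have := measurable_countable_comp (fun p => ((p.1%:R : R)%:E < hit_value p.2)%E) mt.
move=> /(_ measurableT [set true] I); rewrite setTI; congr measurable.
by apply/seteqP; split=> x /=; rewrite hitE.
Qed.

End FirstHit.

(** * Delayed observations *)

Section Delay.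
Context {d : measure_display} {X : measurableType d} {R : realType}.
Variables (T : X -> X) (A : nat -> set X) (a : nat -> R).
Hypothesis mT : measurable_fun setT T.
Hypothesis mA : forall l, measurable (A l).
Hypothesis a0 : forall l, 0 < a l.

(** Off [C l] and on [D l] the delay is short after scaling and precedes the first hit, so
    [scaled_process_iter] and uniform continuity of [f] apply. Elsewhere the integrand is at most
    [2 M], on a set of vanishing measure. The lemma serves both [nu] with delay [tau] and [mu] with
    delay 1. *)
Lemma mean_delay_cvg (f : (nat -> \bar R) -> R) (nu : nat -> probability X R)
    (s : nat -> X -> nat) :
  bcont f -> (forall l, measurable_fun setT (s l)) ->
  (forall eps : R, 0 < eps ->
    nu l [set x | (eps%:E < (a l)%:E * ((s l x)%:R)%:E)%E] @[l --> \oo] --> 0%E) ->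
  nu l [set x | (((s l x)%:R : R)%:E < hit T (A l) x)%E] @[l --> \oo] --> 1%E ->
  let g l x := f (scaled_process T (A l) (a l) x) in
  \int[nu l]_x `|g l (iter (s l x) T x) - g l x| @[l --> \oo] --> 0.
Proof.
move=> cf ms h0 h1 g; have [[M fM] _] := cf.
have gM l x : `|g l x| <= M by apply: fM; exact: scaled_process_seqspace.
have M0 : 0 <= M by apply: le_trans (gM 0%N point).
have mg l : measurable_fun setT (g l).
  exact: (measurable_bcont_process mT (mA l) (a0 l) cf).
have bg l := bmE (mg l) (gM l).
have bgs l : bounded_measurable (fun x => g l (iter (s l x) T x)).
  exact: (bm_comp (measurable_random_iter mT (ms l)) (bg l)).
apply/cvgrPdist_lt => /= e e0.
have [del del0 fdel] : exists2 del : R, 0 < del & forall x y, seqspace x ->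
    seqspace y -> (forall j, dbar (x j) (y j) <= del) -> `|f x - f y| < e / 2.
  by apply: bcont_uniform => //; lra.
pose C l := [set x | (del%:E < (a l)%:E * ((s l x)%:R)%:E)%E].
pose D l := [set x | (((s l x)%:R : R)%:E < hit T (A l) x)%E].
have mC l : measurable (C l).
  have := @measurable_countable_comp _ X _ bool nat (s l)
    (fun k => (del%:E < (a l)%:E * (k%:R)%:E)%E).
  move=> /(_ (fun k => measurable_fiber k (ms l)) measurableT [set true] I).
  by rewrite setTI.
have mD l : measurable (D l) by exact: (measurable_lt_hit mT (mA l) (ms l)).
(* The exceptional set contributes at most [4 M r = e / 2 - 4 r], strictly below [e / 2]. *)
pose r := e / 8 / (M + 1).
have r0 : 0 < r by rewrite /r !divr_gt0// ltr_wpDl.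
have rM : r * M + r = e / 8.
  by rewrite -[X in _ + X]mulr1 -mulrDr /r divfK// gt_eqF// ltr_wpDl.
near=> l; rewrite sub0r normrN ger0_norm; last by apply: Rintegral_ge0.
have nC : fine (nu l (C l)) < r.
  near: l; have /fine_cvgP[_ /cvgrPdist_lt/(_ _ r0)] := h0 _ del0.
  by apply: filterS => l /=; rewrite sub0r normrN => /(le_lt_trans (ler_norm _)).
have nD : 1 - fine (nu l (D l)) < r.
  near: l; have /fine_cvgP[_ /cvgrPdist_lt/(_ _ r0)] := h1.
  by apply: filterS => l /=; exact: le_lt_trans (ler_norm _).
have bC := bm_indic (R := R) (mC l); have bD := bm_indic (R := R) (mD l).
have b1 := bm_cst (X := X) (1 : R).
have le1 : \int[nu l]_x `|g l (iter (s l x) T x) - g l x| <=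
   \int[nu l]_x (e / 2 + (2 * M) * (\1_(C l) x + (1 - \1_(D l) x))).
  apply: le_mean.
  - by apply: bm_norm; exact: bmB.
  - by apply: bmD; [exact: bm_cst|apply: bmZ; apply: bmD => //; exact: bmB].
  move=> x; have le2 : `|g l (iter (s l x) T x) - g l x| <= 2 * M.
    apply: le_trans (ler_normB _ _) _.
    have := gM l x; have := gM l (iter (s l x) T x); lra.
  rewrite !indicE; have [xC|xC] := boolP (x \in C l) => /=.
    by case: (x \in D l) => /=; lra.
  have [xD|xD] := boolP (x \in D l) => /=; last lra.
  rewrite subrr addr0 mulr0 addr0 distrC ltW//; apply: fdel.
  - exact: scaled_process_seqspace.
  - exact: scaled_process_seqspace.
  move=> j; apply: le_trans (scaled_process_iter (a0 l) j (set_mem xD)) _.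
  have : ~ C l x by move=> /mem_set; rewrite (negbTE xC).
  by rewrite /C /= -EFinM lte_fin => /negP; rewrite -leNgt.
apply: le_lt_trans le1 _.
rewrite meanD; last 2 first.
- exact: bm_cst.
- by apply: bmZ; apply: bmD => //; exact: bmB.
rewrite mean_cst meanZ; last by apply: bmD => //; exact: bmB.
rewrite meanD//; last exact: bmB.
rewrite meanB// mean_cst !mean_indic//.
have : 2 * M * (fine (nu l (C l)) + (1 - fine (nu l (D l)))) <= 2 * M * (r + r).
  by rewrite ler_wpM2l ?mulr_ge0// lerD// ltW.
have := r0; lra.
Unshelve. all: end_near. Qed.

End Delay.

(** * Transfer of the limit law *)

(** The limit is an extended real because [weak_conv] states its limit as an extended integral. Each
    implication of the theorem is one use of this lemma. *)
Lemma cvge_subr0 {R : realType} (u v : nat -> R) (c : \bar R) :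
  u l - v l @[l --> \oo] --> 0 ->
  (u l)%:E @[l --> \oo] --> c -> (v l)%:E @[l --> \oo] --> c.
Proof.
move=> uv uc; rewrite -[c]sube0.
have -> : (fun l => (v l)%:E) = (fun l => (u l)%:E - (u l - v l)%:E)%E.
  by apply/funext => l; rewrite -EFinB; congr EFin; ring.
apply: cvgeB => //; first by case: c uc.
by apply/fine_cvgP; split=> //; exact: nearW.
Qed.

Unset Implicit Arguments.

Theorem mainTheorem1 (d : measure_display) (X : measurableType d) (R : realType)
  (mu : probability X R) (T : X -> X)
  (hTmp : measure_preserving mu T) (hTerg : ergodic mu T)
  (A : nat -> set X)
  (hAmeas : forall l, measurable (A l))
  (hApos : forall l, (0 < mu (A l))%E)
  (hArare : (mu \o A) @ \oo --> 0%E)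
  (nu : nat -> probability X R) (hnuP : forall l, Pfrak mu (nu l))
  (tau : nat -> X -> nat) (htaumeas : forall l, measurable_fun setT (tau l))
  (htau0 : forall eps : R, 0 < eps ->
     (fun l => nu l [set x | (eps%:E < mu (A l) * ((tau l x)%:R)%:E)%E]) @ \oo --> 0%E)
  (htau1 : (fun l => nu l [set x | ((((tau l x)%:R : R))%:E < hit T (A l) x)%E]) @ \oo --> 1%E)
  (K : set (probability X R)) (hK : dP_compact mu K)
  (hTtau : forall l, exists2 rho : probability X R, K rho &
     forall B, measurable B -> rho B = nu l ((fun x => iter (tau l x) T x) @^-1` B))
  (d' : measure_display) (Om : measurableType d') (P : probability Om R)
  (Phi : Om -> nat -> \bar R)
  (hPhimeas : forall j, measurable_fun setT (fun w => Phi w j))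
  (hPhival : forall w, seqspace (Phi w)) :
  weak_conv nu (fun l x j => (mu (A l) * hit_process T (A l) x j)%E) P Phi <->
  weak_conv (fun _ => mu) (fun l x j => (mu (A l) * hit_process T (A l) x j)%E) P Phi.
Proof.
have [mT _] := hTmp.
pose a l := fine (mu (A l)).
have aE l : mu (A l) = (a l)%:E by rewrite /a fineK// fin_num_measure.
have a0 l : 0 < a l by rewrite -lte_fin -aE.
have acvg : a l @[l --> \oo] --> 0 by have /fine_cvgP[] := hArare.
(* Weak convergence is tested function by function, so it is enough that the two integrals of each
   test function merge; this does not involve [Phi]. *)
suff main (f : (nat -> \bar R) -> R) : bcont f ->
    let g l x := f (scaled_process T (A l) (a l) x) in
    [/\ forall l, bounded_measurable (g l) &
      \int[nu l]_x g l x - \int[mu]_x g l x @[l --> \oo] --> 0].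
  have gE (f : (nat -> \bar R) -> R) l x :
      f (fun j => mu (A l) * hit_process T (A l) x j)%E =
      f (scaled_process T (A l) (a l) x).
    by congr f; apply/funext => j; rewrite aE.
  have intE (eta : probability X R) (h : X -> R) : bounded_measurable h ->
      (\int[eta]_x (h x)%:E = (Rintegral eta setT h)%:E)%E.
    by move=> bh; rewrite /Rintegral fineK//; exact/integrable_fin_num/bm_integrable.
  have weakE (eta : nat -> probability X R) (f : (nat -> \bar R) -> R) : bcont f ->
      (fun l => \int[eta l]_x
        (f (fun j => mu (A l) * hit_process T (A l) x j)%E)%:E)%E
      = (fun l => (\int[eta l]_x f (scaled_process T (A l) (a l) x))%:E).
    move=> cf; have [bg _] := main f cf.
    apply/funext => l; rewrite -(intE _ _ (bg l)).
    by apply: eq_integral => x _; rewrite gE.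
  split=> W f cf; have := W f cf; rewrite !weakE//; have [bg dg] := main f cf.
    exact: cvge_subr0.
  apply: cvge_subr0; move/cvgN: dg; rewrite oppr0; apply: cvg_trans.
  by apply: near_eq_cvg; apply: nearW => l /=; rewrite opprB.
move=> cf g; have [[M fM] _] := cf.
have gM l x : `|g l x| <= M by apply: fM; exact: scaled_process_seqspace.
have mg l : measurable_fun setT (g l).
  exact: (measurable_bcont_process mT (hAmeas l) (a0 l) cf).
have bg l := bmE (mg l) (gM l).
split=> //.
(* Asymptotic invariance under [mu]: the delay is the constant 1, negligible after scaling because
   [a l] tends to 0. *)
have gT : \int[mu]_x `|g l (T x) - g l x| @[l --> \oo] --> 0.
  apply: (mean_delay_cvg mT hAmeas a0 (nu := fun=> mu) (s := fun _ _ => 1%N) cf) => //.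
    move=> eps eps0; apply: cvg_near_cst.
    have /cvgrPdist_lt/(_ _ eps0) := acvg; apply: filterS => l.
    rewrite sub0r normrN gtr0_norm// => al.
    rewrite (_ : [set x | _] = set0) ?measure0//; apply/seteqP; split=> // x /=.
    by rewrite mule1 lte_fin ltNge (ltW al).
  apply/fine_cvgP; split; first by apply: nearW => l; rewrite fin_num_measure//;
    exact: (measurable_lt_hit mT (hAmeas l)).
  apply/cvgrPdist_lt => /= e e0.
  have /cvgrPdist_lt/(_ _ e0) := acvg; apply: filterS => l.
  rewrite sub0r normrN gtr0_norm// => al; set D := [set x | _].
  have mD : measurable D by exact: (measurable_lt_hit mT (hAmeas l)).
  (* Off [D] the first hit occurs at time 1, that is, [T x] lies in [A l]; by invariance this has
     measure [mu (A l)], which tends to 0. *)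
  have -> : 1 - fine (mu D) = fine (mu (~` D)).
    by rewrite probability_setC// fineB// fin_num_measure.
  rewrite ger0_norm ?fine_ge0//; apply: le_lt_trans al.
  rewrite fine_le ?fin_num_measure//; first exact: measurableC.
  have [_ /(_ _ (hAmeas l)) <-] := hTmp.
  have mTA : measurable (T @^-1` A l).
    by rewrite -[X in measurable X]setTI; exact: mT.
  apply: le_measure; rewrite ?inE//; first exact: measurableC.
  move=> x; apply: contra_notP => nA; rewrite /D /= hitE /hit_value.
  case: first_hitP => [_|n [_ An] _] /=; first exact: ltry.
  by rewrite lte_fin ltr_nat; case: n An.
have dn : \int[nu l]_x `|g l (iter (tau l x) T x) - g l x| @[l --> \oo] --> 0.
  apply: (mean_delay_cvg mT hAmeas a0 cf) => // eps eps0.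
  by under eq_fun do rewrite -aE; exact: htau0.
(* [rho l] is the law of [T^tau] under [nu l], an element of [K]; compactness makes its integrals
   merge with those of [mu]. *)
have /choice[rho rhoP] : forall l, exists r : probability X R, K r /\
    forall B, measurable B -> r B = nu l ((fun x => iter (tau l x) T x) @^-1` B).
  by move=> l; have [r Kr rE] := hTtau l; exists r.
have rK := mean_compact_cvg hTmp hTerg mg gM gT hK (fun l => (rhoP l).1).
have mTt l := measurable_random_iter mT (htaumeas l).
have rE l : \int[rho l]_x g l x = \int[nu l]_x g l (iter (tau l x) T x).
  by apply: mean_pushforward => //; have [] := rhoP l.
(* Triangle inequality through [rho l]: [rK] compares it with [mu], and [dn] compares it with [nu l]
   after the change of variables [rE]. *)
apply/cvgrPdist_lt => /= e e0; have e2 : 0 < e / 2 by lra.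
near=> l; rewrite sub0r normrN.
apply: le_lt_trans (ler_distD (\int[rho l]_x g l x) _ _) _.
have h1 : `|\int[rho l]_x g l x - \int[mu]_x g l x| < e / 2.
  near: l; have /cvgrPdist_lt/(_ _ e2) := rK.
  by apply: filterS => l; rewrite sub0r normrN.
have h2 : \int[nu l]_x `|g l (iter (tau l x) T x) - g l x| < e / 2.
  near: l; have /cvgrPdist_lt/(_ _ e2) := dn.
  by apply: filterS => l; rewrite sub0r normrN => /(le_lt_trans (ler_norm _)).
have := le_norm_meanB (nu l) (bm_comp (mTt l) (bg l)) (bg l).
rewrite -rE distrC /= => h3; lra.
Unshelve. all: end_near. Qed.
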